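(* Let $k\ge 1$ and $n\ge 1$ be integers and let $\lambda$ be a partition. The number of large $(k,k)$-Fuss-Schröder paths of length $n$ and type $\lambda$ is \[ \frac{1}{n}\left(\binom{n}{|\lambda|+1}+\frac{|\lambda|}{kn+1}\binom{n+1}{|\lambda|+1}\right)\binom{kn+1}{\ell(\lambda)}\frac{\ell(\lambda)!}{m_\lambda}. \] The number of large $(k,k)$-Fuss-Schröder paths of length $n$ and type $\lambda$ which end in a diagonal step is \[ \frac{1}{n} \binom{n}{|\lambda|+1}\binom{kn}{\ell(\lambda)}\frac{\ell(\lambda)!}{m_\lambda}. \]
   Context: For a partition $\lambda$ (possibly empty), $\ell(\lambda)$ is its number of parts, $|\lambda|$ the sum of its parts, $m_i(\lambda)$ the number of parts equal to $i$, and $m_\lambda=m_1(\lambda)!\,m_2(\lambda)!\,m_3(\lambda)!\cdots$. Binomial coefficients $\binom{a}{b}$ with $b<0$ or $b>a\ge 0$ are $0$. A large $(k,k)$-Fuss-Schröder path of length $n$ is a lattice path from $(0,0)$ to $(n,kn)$ using east steps $(1,0)$, north steps $(0,1)$ and diagonal steps $(1,1)$, which stays nonstrictly above the line $y=kx$, and such that each diagonal step goes from the line $y=kj+k-1$ to the line $y=kj+k$ for some integer $j$. The type of such a path is the partition whose parts are the lengths of the maximal runs of consecutive east steps in the path. *)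

(* Defs.v *)
From HB Require Import structures.
From mathcomp Require Import all_boot all_order all_algebra.
From mathcomp Require Import zify.

Set Implicit Arguments.
Unset Strict Implicit.
Unset Printing Implicit Defensive.

(* Partitions are nonincreasing lists of positive naturals, so that
   l(la) = size la, |la| = sumn la and m_i(la) = count_mem i la. *)
Definition is_partition (la : seq nat) : bool := sorted geq la && (0 \notin la).

(* The product m_1! m_2! m_3! ...; parts of la are at most |la|, so all further
   factors are 0! = 1. *)
Definition mult_fact (la : seq nat) : nat :=
  \prod_(1 <= i < (sumn la).+1) (count_mem i la)`!.

Inductive step := East | North | Diag.

Definition step_encode (s : step) : option bool :=
  match s with East => None | North => Some true | Diag => Some false end.
Definition step_decode (o : option bool) : step :=
  match o with None => East | Some true => North | Some false => Diag end.
Lemma step_encodeK : cancel step_encode step_decode.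
Proof. by case. Qed.

HB.instance Definition _ := Equality.copy step (can_type step_encodeK).
HB.instance Definition _ := Choice.copy step (can_type step_encodeK).
HB.instance Definition _ := Countable.copy step (can_type step_encodeK).
HB.instance Definition _ : isFinite step := CanIsFinite step_encodeK.

(* A lattice path from the origin is the list of its steps; (xend p, yend p) is
   its endpoint. *)
Definition xend (p : seq step) : nat := count_mem East p + count_mem Diag p.
Definition yend (p : seq step) : nat := count_mem North p + count_mem Diag p.

(* The horizontal line at height y is one of the lines y = kj + k - 1. *)
Definition diag_start (k y : nat) : bool := y == k.-1 %[mod k].

Lemma diag_startP (k y : nat) : 0 < k ->
  reflect (exists j : int, Posz y = (Posz k * j + Posz k - 1)%R)
          (diag_start k y).
Proof.
case: k => // k _; apply: (iffP eqP) => /= [e | [j e]].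
  exists (Posz (y %/ k.+1)).
  rewrite {1}(divn_eq y k.+1) e (modn_small (ltnSn k)) mulnC.
  by rewrite PoszD PoszM -addn1 PoszD GRing.addrA GRing.addrK.
have {}e : (Posz y.+1 = Posz k.+1 * (j + 1))%R.
  by rewrite -addn1 PoszD e GRing.subrK GRing.mulrDr GRing.mulr1.
have dv : k.+1 %| y.+1.
  have : (Posz k.+1 %| Posz y.+1)%Z by rewrite e dvdz_mulr.
  by [].
by apply/eqP; rewrite -(eqn_modDr 1) !addn1 modnn -/(dvdn k.+1 y.+1).
Qed.

(* Large (k,k)-Fuss-Schroeder paths of length n. As both a step and the region
   kx <= y are convex, it is enough to test that the vertices of the path lie
   in that region. A diagonal step raises the height by 1, so only its starting
   height has to be constrained. *)
Definition is_fuss_schroder (k n : nat) (p : seq step) : bool :=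
  [&& xend p == n, yend p == k * n,
      all (fun i => k * xend (take i p) <= yend (take i p)) (iota 0 (size p).+1)
    & all (fun i => (nth East p i == Diag) ==> diag_start k (yend (take i p)))
        (iota 0 (size p))].

Definition ends_diag (p : seq step) : bool := last North p == Diag.

(* The lengths, possibly 0, of the blocks of east steps delimited by the
   successive non-east steps, when the first block already contains r steps. *)
Fixpoint east_blocks (r : nat) (p : seq step) : seq nat :=
  match p with
  | [::] => [:: r]
  | East :: q => east_blocks r.+1 q
  | _ :: q => r :: east_blocks 0 q
  end.

Definition path_type (p : seq step) : seq nat :=
  sort geq [seq r <- east_blocks 0 p | 0 < r].

(* A path from (0,0) to (n,kn) has at most n + kn steps. Hence counting inside
   the finite type of step sequences of bounded size misses no path. *)
Lemma size_fuss_schroder k n p : is_fuss_schroder k n p -> size p <= n + k * n.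
Proof.
case/and4P => /eqP <- /eqP <- _ _; rewrite /xend /yend.
by elim: p => //= -[] p IHp /=; lia.
Qed.

Definition num_fuss_schroder (k n : nat) (la : seq nat) : nat :=
  #|[set p : {bseq n + k * n of step} |
      is_fuss_schroder k n p && (path_type p == la)]|.

Definition num_fuss_schroder_diag (k n : nat) (la : seq nat) : nat :=
  #|[set p : {bseq n + k * n of step} |
      [&& is_fuss_schroder k n p, path_type p == la & ends_diag p]]|.

(* Main.v *)
Require Import Defs.
From mathcomp Require Import all_boot all_order all_algebra.
From mathcomp Require Import zify ring.

Set Implicit Arguments.
Unset Strict Implicit.
Unset Printing Implicit Defensive.

Import Order.TTheory GRing.Theory Num.Theory.

(* A path is determined by the lengths b_0, ..., b_{kn} of its (possibly empty)
   east blocks, one at each height, and by the bits g_1, ..., g_n recording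
   whether the step from the line y = kj - 1 to the line y = kj is a north
   step. Putting g_0 = 1, staying above the line y = kx means that
   b_0 + ... + b_{kj-1} < g_0 + ... + g_{j-1} for j = 1, ..., n, and ending at
   (n, kn) means that g has |la| + 1 ones. Rotate the n pairs formed by k
   consecutive entries of b (without b_{kn}) and one entry of g (without g_n):
   by the cycle lemma the number of rotations satisfying the inequalities is the
   total excess (|la| + 1 - g_n) - (|la| - b_{kn}) = (1 - g_n) + b_{kn}. So n
   times the number of paths is the sum of (1 - g_n) + b_{kn} over all pairs
   (b, g), and the mean of b_{kn} is |la| / (kn + 1) by symmetry. Paths ending
   in a diagonal step are those with b_{kn} = g_n = 0. *)

(** * The cycle lemma for integer sequences *)

Section CycleLemma.

Variable u : nat -> int.

Fixpoint window_min (r l : nat) : int :=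
  if l is l'.+1 then Num.min (u r) (window_min r.+1 l') else u r.

Lemma window_min_le r l j : j <= l -> (window_min r l <= u (r + j))%R.
Proof.
elim: l r j => [|l IHl] r [|j] //= hj; rewrite ?addn0 ?lexx //.
  by rewrite ge_min lexx.
by rewrite addnS -addSn ge_min IHl // orbT.
Qed.

Lemma window_min_attained r l : exists2 j, j <= l & window_min r l = u (r + j).
Proof.
elim: l r => [|l IHl] r /=; first by exists 0; rewrite ?addn0.
case: (leP (u r) (window_min r.+1 l)) => _; first by exists 0; rewrite ?addn0.
by have [j hj ->] := IHl r.+1; exists j.+1; rewrite // addnS.
Qed.

(* With [M r] the minimum of [u] on the window [r, r + n], the bound on upward
   steps gives [M (r + 1) = M r + 1] when [r] is counted and [M (r + 1) = M r]
   otherwise, so the sum telescopes to [M n - M 0 = s]. *)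
Lemma cycle_lemma n s :
  (forall m, m < n + n -> (u m.+1 <= u m + 1)%R) ->
  (forall m, m <= n -> (u (m + n) = u m + s%:Z)%R) ->
  \sum_(r < n) all (fun j => (u r < u (r + j))%R) (iota 1 n) = s.
Proof.
move=> ustep uper.
have shift r l : r + l <= n -> (window_min (r + n) l = window_min r l + s%:Z)%R.
  elim: l r => [|l IHl] r hrl /=; first by rewrite uper //; lia.
  by rewrite -addSn IHl ?uper; lia.
have step r : r < n -> (window_min r.+1 n = window_min r n +
    (all (fun j => (u r < u (r + j))%R) (iota 1 n) : nat)%:Z)%R.
  move=> hr; have st := ustep r; have per := uper r.+1.
  have le0 := window_min_le r (leq0n n); rewrite addn0 in le0.
  have le1 := window_min_le r (leq_ltn_trans (leq0n r) hr).
  rewrite addn1 in le1.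
  have le1' := window_min_le r.+1 (leq0n n); rewrite addn0 in le1'.
  (* Moving the window drops [u r] and adds [u (r + 1 + n)], which equals [u (r + 1) + s] and so
     cannot lower the minimum. *)
  have ge : (window_min r n <= window_min r.+1 n)%R.
    have [j hj ->] := window_min_attained r.+1 n.
    case: (ltnP j n) => jn; first by rewrite addSn -addnS window_min_le.
    have -> : j = n by lia.
    by rewrite per //; lia.
  have [i hi ei] := window_min_attained r n.
  case: allP => [good | /allP/allPn[j]] /=.
    have gt : (u r < window_min r.+1 n)%R.
      have [j hj ->] := window_min_attained r.+1 n.
      case: (ltnP j n) => jn; first by rewrite addSn -addnS good // mem_iota; lia.
      have -> : j = n by lia.
      have := good 1; rewrite mem_iota addn1 => g1.
      by rewrite per //; have := g1; lia.
    (* When [r] is counted, the old minimum is [u r] itself, and the new one lies strictly above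
       [u r] but at most at [u (r + 1) <= u r + 1]. *)
    case: i hi ei => [|i] hi ei; first by rewrite addn0 in ei; lia.
    by have := good i.+1; rewrite mem_iota; lia.
  rewrite mem_iota -leNgt => hj lej.
  (* The offending index [r + j] belongs to the next window too, so losing [u r] does not raise the
     minimum. *)
  have lej' : (window_min r.+1 n <= u (r + j))%R.
    by case: j hj lej => [|j] hj _; rewrite ?addnS -?addSn ?window_min_le; lia.
  case: i hi ei => [|i] hi ei; first by rewrite addn0 in ei; lia.
  have := @window_min_le r.+1 n i; rewrite addSn -addnS; lia.
have tele m : m <= n -> (window_min m n = window_min 0 n + (\sum_(r < m)
    all (fun j => (u r < u (r + j))%R) (iota 1 n))%:Z)%R.
  elim: m => [|m IHm] hm; first by rewrite big_ord0 addr0.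
  by rewrite big_ord_recr /= step // IHm ?PoszD ?addrA // ltnW.
have := tele n (leqnn n); have := shift 0 n (leqnn n); rewrite add0n => ->.
by move/addrI => [].
Qed.

End CycleLemma.

(** * Rotations of pairs of words *)

Definition dominated (k n : nat) (b : seq nat) (g : seq bool) : bool :=
  all (fun j => sumn (take (k * j) b) < count id (take j g)) (iota 1 n).

(** The entries from position [m] on stay in place: the last block and the last bit determine the
    excess and must not move. *)
Definition rot_prefix (T : Type) (m r : nat) (s : seq T) : seq T :=
  rot r (take m s) ++ drop m s.

Lemma drop_rot_prefix (T : Type) m r (s : seq T) :
  drop m (rot_prefix m r s) = drop m s.
Proof.
rewrite /rot_prefix; case: (leqP (size s) m) => hm.
  by rewrite (drop_oversize hm) cats0 drop_oversize // size_rot size_take_min; lia.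
by rewrite drop_size_cat // size_rot size_takel // ltnW.
Qed.

Lemma rot_prefix_inj (T : eqType) m r : injective (@rot_prefix T m r).
Proof.
move=> s t e; have ed := congr1 (drop m) e; rewrite !drop_rot_prefix in ed.
rewrite -(cat_take_drop m s) -(cat_take_drop m t) ed; congr (_ ++ _).
have se : size (rot r (take m s)) = size (rot r (take m t)).
  by have := congr1 size e; rewrite /rot_prefix !size_cat ed; lia.
by move/eqP: e; rewrite /rot_prefix eqseq_cat // => /andP[/eqP /rot_inj].
Qed.

Lemma perm_rot_prefix (T : eqType) m r (s : seq T) : perm_eq (rot_prefix m r s) s.
Proof.
by rewrite -[X in perm_eq _ X](cat_take_drop m) perm_cat2r perm_rot.
Qed.

(** Reading a rotation as a factor of the doubled word turns its prefix sums into differences of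
    prefix sums of one fixed sequence. *)
Lemma take_rot_prefix (T : Type) m r i (s : seq T) : m <= size s -> r <= m ->
  i <= m -> take i (rot_prefix m r s) = take i (drop r (take m s ++ take m s)).
Proof.
move=> hm hr hi; rewrite /rot_prefix takel_cat; last by rewrite size_rot size_takel.
rewrite drop_cat size_takel //; case: ltnP => [_ | rm].
  rewrite -{3}(cat_take_drop r (take m s)) catA takel_cat //.
  by rewrite -/(rot r _) size_rot size_takel.
have -> : r = m by lia.
by rewrite subnn drop0 rot_oversize // size_takel.
Qed.

Lemma sum_dominated_rot (k n : nat) (b : seq nat) (g : seq bool) :
  size b = (k * n).+1 -> size g = n.+1 -> count id g = (sumn b).+1 ->
  \sum_(r < n) dominated k n (rot_prefix (k * n) (k * r) b) (rot_prefix n r g)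
    = ~~ last true g + last 0 b.
Proof.
case/lastP: b => // b t; case/lastP: g => // g e.
rewrite !size_rcons !last_rcons => -[sb] [sg].
rewrite sumn_rcons => cg0; have := cg0.
rewrite -{1}cats1 count_cat /= addn0 => cg.
(* One step of [u] consumes one bit and [k] entries of [b], so [u] rises by at most 1; over a full
   period it gains the excess [~~ e + t]. *)
pose u m : int := ((count id (take m (g ++ g)))%:Z
                   - (sumn (take (k * m) (b ++ b)))%:Z)%R.
rewrite -(@cycle_lemma u n (~~ e + t)).
- apply: eq_bigr => r _; congr (nat_of_bool _); apply: eq_in_all => j.
  rewrite mem_iota => /andP[_ hj]; have hr := ltn_ord r.
  have tb : take (k * n) (rcons b t) = b by rewrite -sb -cats1 take_size_cat.
  have tg : take n (rcons g e) = g by rewrite -sg -cats1 take_size_cat.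
  rewrite !take_rot_prefix ?size_rcons ?leq_mul2l ?sb ?sg; try lia.
  rewrite tb tg /u mulnDr !takeD count_cat sumn_cat; lia.
- move=> m hm; rewrite /u -[m.+1]addn1 mulnDr !takeD count_cat sumn_cat.
  have := count_size id (take 1 (drop m (g ++ g))).
  rewrite size_take_min; lia.
move=> m hm; rewrite /u addnC mulnDr !takeD !count_cat !sumn_cat.
rewrite (take_size_cat _ sb) (take_size_cat _ sg) (drop_size_cat _ sb).
rewrite (drop_size_cat _ sg) !takel_cat ?sb ?sg ?leq_mul2l; lia.
Qed.

(** * Enumeration of bit words and of words of a given type *)

(** Induction on the length, splitting by the first letter [x]: by induction these rearrangements
    contribute [count_mem x s] times the factorial of the shorter length, and the multiplicities add
    up to [size s]. Letters of [r] absent from [s] contribute 0! = 1. *)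
Lemma size_permutations_multinomial (T : eqType) (r s : seq T) :
  uniq r -> {subset s <= r} ->
  size (permutations s) * \prod_(x <- r) (count_mem x s)`! = (size s)`!.
Proof.
move=> ur; move: {2}(size s) (erefl (size s)) => m.
elim: m s => [|m IHm] s es sr.
  case: s es sr => // _ _; rewrite (eq_bigr (fun=> 1)) //.
  by rewrite big1_eq.
rewrite (perm_size (permutationsE _)) ?es //.
rewrite size_allpairs_dep sumnE big_map big_distrl /=.
rewrite (eq_big_seq (fun x => count_mem x s * m`!)) => [|x]; last first.
  rewrite mem_undup => xs.
  have sx : size (rem x s) = m by rewrite size_rem // es.
  rewrite -sx -(IHm (rem x s)) ?sx // => [|y /mem_rem /sr //].
  rewrite mulnCA; congr (_ * _); rewrite !(bigD1_seq x) ?sr //=.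
  have cx := count_rem x (pred1 x) s.
  have cp : 0 < count_mem x s by rewrite -has_count has_pred1 //.
  rewrite xs /= eqxx /= in cx.
  rewrite mulnA; congr (_ * _).
    by case: (count_mem x s) cp cx => // c _ ->; rewrite subn1 factS.
  apply: eq_bigr => y yx; congr (_)`!.
  by rewrite count_rem xs /= eq_sym (negbTE yx) subn0.
rewrite -big_distrl factS -es; congr (_ * _) => /=.
rewrite -[RHS](perm_size (perm_count_undup s)) size_flatten /shape -map_comp.
by rewrite sumnE big_map; apply: eq_bigr => x _; rewrite /= size_nseq.
Qed.

Fixpoint bool_words (n c : nat) : seq (seq bool) :=
  match n, c with
  | 0, 0 => [:: [::]]
  | 0, _.+1 => [::]
  | n'.+1, 0 => map (cons false) (bool_words n' 0)
  | n'.+1, c'.+1 =>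
      map (cons false) (bool_words n' c) ++ map (cons true) (bool_words n' c')
  end.

Lemma size_bool_words n c : size (bool_words n c) = 'C(n, c).
Proof.
elim: n c => [|n IHn] [|c] //=; first by rewrite size_map IHn !bin0.
by rewrite size_cat !size_map !IHn binS.
Qed.

Lemma mem_bool_words n c g :
  (g \in bool_words n c) = (size g == n) && (count id g == c).
Proof.
have mem_cons x y (s : seq (seq bool)) t :
    (x :: t \in map (cons y) s) = (x == y) && (t \in s).
  apply/mapP/andP => [[t' hs [-> ->]]|[/eqP -> hs]]; first by rewrite eqxx.
  by exists t.
have mem_nil y (s : seq (seq bool)) : ([::] \in map (cons y) s) = false.
  by apply/mapP => -[].
elim: n c g => [|n IHn] [|c] [|x g] //=;
  rewrite ?mem_cat ?mem_cons ?mem_nil // !IHn eqSS; case: x => //=;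
  by rewrite ?add0n ?add1n ?eqSS ?andbF ?orbF.
Qed.

Lemma bool_words_uniq n c : uniq (bool_words n c).
Proof.
have inj x : injective (@cons bool x) by move=> s t [].
elim: n c => [|n IHn] [|c] //=; first by rewrite map_inj_uniq.
rewrite cat_uniq !map_inj_uniq // !IHn /= andbT.
by apply/hasPn => _ /mapP[t _ ->]; apply/mapP => -[].
Qed.

Lemma sum_nat_pred (T : Type) (p : pred T) (s : seq T) :
  \sum_(x <- s) (p x : nat) = count p s.
Proof. by rewrite -sumn_count sumnE big_map. Qed.

(** Deleting the final [false] is a bijection onto the words of length [n] with [c] ones. *)
Lemma bool_words_last_false n c :
  \sum_(g <- bool_words n.+1 c) (~~ last true g : nat) = 'C(n, c).
Proof.
rewrite (sum_nat_pred (fun g => ~~ last true g)) -size_filter -size_bool_words.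
have inj : injective (rcons^~ false) by move=> s t /rcons_inj[].
rewrite -[RHS](size_map (rcons^~ false)); apply: perm_size; apply: uniq_perm.
- by rewrite filter_uniq // bool_words_uniq.
- by rewrite map_inj_uniq // bool_words_uniq.
move=> g; rewrite mem_filter mem_bool_words; apply/idP/mapP => [|[h]].
  case/lastP: g => [|g [|]]; rewrite ?last_rcons //= => /andP[].
  rewrite size_rcons eqSS -cats1 count_cat addn0 => sg cg.
  by exists g; rewrite ?mem_bool_words ?sg // cats1.
rewrite mem_bool_words => /andP[sh ch] ->; rewrite last_rcons size_rcons eqSS sh.
by rewrite -cats1 count_cat addn0.
Qed.

(** Rearrangements of [la] padded with zeros to length [m]. The filter matters when [la] has more
    than [m] parts: the subtraction then truncates to 0, and the list has to be empty. *)
Definition type_words (m : nat) (la : seq nat) : seq (seq nat) :=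
  [seq b <- permutations (la ++ nseq (m - size la) 0) | size b == m].

Lemma type_words_uniq m la : uniq (type_words m la).
Proof. by rewrite filter_uniq // permutations_uniq. Qed.

Lemma geq_sortP (s t : seq nat) : reflect (sort geq s = sort geq t) (perm_eq s t).
Proof.
by apply: perm_sortP => [x y|x y z|x y]; rewrite /geq /=; lia.
Qed.

Lemma sort_partition la : is_partition la -> sort geq la = la.
Proof.
by case/andP => + _; apply: sorted_sort => x y z; rewrite /geq /=; lia.
Qed.

Lemma filter_partition la : is_partition la -> [seq r <- la | 0 < r] = la.
Proof.
case/andP => _ la0; apply/all_filterP/allP => -[|//].
by rewrite (negbTE la0).
Qed.

(** The condition on the right is the one by which [path_type] reads a type off the list of east
    blocks. *)
Lemma mem_type_words m la b : is_partition la ->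
  (b \in type_words m la) =
    (size b == m) && (sort geq [seq r <- b | 0 < r] == la).
Proof.
move=> hla; rewrite mem_filter mem_permutations; case: eqP => //= sb.
have eq0 (s : seq nat) : [seq x <- s | predC (fun r => 0 < r) x]
    = nseq (count_mem 0 s) 0.
  have -> : [seq x <- s | predC (fun r => 0 < r) x] = [seq x <- s | pred1 0 x].
    by apply: eq_filter => -[].
  by rewrite -size_filter; apply/all_pred1P/filter_all.
apply/idP/eqP => [pb|tb].
  rewrite -[RHS](sort_partition hla); apply/geq_sortP.
  apply: (perm_trans (perm_filter _ pb)).
  by rewrite filter_cat filter_partition // filter_nseq cats0.
have pla : perm_eq [seq r <- b | 0 < r] la.
  by apply/geq_sortP; rewrite tb sort_partition.
rewrite -(perm_filterC (fun r => 0 < r) b) eq0.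
have sf := perm_size pla; rewrite size_filter in sf.
have := count_predC (fun r => 0 < r) b; rewrite sf sb -size_filter eq0 size_nseq.
by move=> <-; rewrite addKn perm_cat2r.
Qed.

Lemma type_words_perm m la b c :
  perm_eq b c -> (b \in type_words m la) = (c \in type_words m la).
Proof.
move=> bc; rewrite !mem_filter !mem_permutations (perm_size bc).
by rewrite (permPl bc).
Qed.

Lemma sumn_type_words m la b : b \in type_words m la -> sumn b = sumn la.
Proof.
rewrite mem_filter mem_permutations => /andP[_ /perm_sumn ->].
by rewrite sumn_cat sumn_nseq mul0n addn0.
Qed.

(** Multiplied by the factorial of [m - size la], both sides become m!, by the multinomial count
    applied to the padded word. If [la] has more than [m] parts, both sides vanish. *)
Lemma size_type_words m la : is_partition la ->
  size (type_words m la) * mult_fact la = 'C(m, size la) * (size la)`!.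
Proof.
move=> hla; case: (leqP (size la) m) => hm; last first.
  rewrite bin_small // mul0n; apply/eqP; rewrite muln_eq0 size_filter.
  rewrite -leqn0 leqNgt -has_count; apply/orP; left; apply/hasPn => b.
  rewrite mem_permutations => /perm_size; rewrite size_cat size_nseq => ->.
  by rewrite gtn_eqF // (leq_trans hm) // leq_addr.
have all_m b : b \in permutations (la ++ nseq (m - size la) 0) -> size b == m.
  by rewrite mem_permutations => /perm_size ->; rewrite size_cat size_nseq subnKC.
rewrite /type_words (all_filterP (introT allP all_m)).
apply/eqP; rewrite -(eqn_pmul2r (fact_gt0 (m - size la))) -!mulnA bin_fact //.
set s := la ++ _; have ss : size s = m by rewrite size_cat size_nseq subnKC.
rewrite -[X in _ == X`!]ss -(@size_permutations_multinomial _ (index_iota 0 (sumn la).+1));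
  last 2 first.
- exact: iota_uniq.
- move=> x; rewrite mem_cat mem_nseq mem_index_iota => /orP[xla|].
    by rewrite ltnS sumnE (big_rem x) //= leq_addr.
  by case/andP => _ /eqP ->.
(* The letter 0 is split off: it occurs only in the padding, and its factor is the factorial of
   [m - size la]. The other letters give [mult_fact la]. *)
rewrite big_ltn //; apply/eqP; congr (_ * _).
have /andP[_ la0] := hla.
rewrite mulnC count_cat count_nseq (count_memPn la0) mul1n; congr (_ * _).
rewrite /mult_fact; apply: eq_big_nat => -[|i] // _.
by rewrite count_cat count_nseq addn0.
Qed.

(** * Averaging over rotations *)

Lemma perm_map_closed (T : eqType) (f : T -> T) (s : seq T) :
  uniq s -> injective f -> {in s, forall x, f x \in s} ->
  perm_eq (map f s) s.
Proof.
move=> us inj fs; have ufs : uniq (map f s) by rewrite map_inj_uniq.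
apply: uniq_perm => //; have sub : {subset map f s <= s}.
  by move=> _ /mapP[x xs ->]; apply: fs.
by case: (uniq_min_size ufs sub); rewrite ?size_map.
Qed.

Lemma last_rot_prefix (T : Type) (x : T) m r s :
  m < size s -> last x (rot_prefix m r s) = last x s.
Proof.
move=> hm; rewrite /rot_prefix -[in RHS](cat_take_drop m s) !last_cat.
by case E: (drop m s) => //; move/(congr1 size): E; rewrite size_drop /=; lia.
Qed.

(** Rotating prefixes permutes both lists of words and fixes the last entries, on which alone [Q]
    depends. So the sum may be replaced by its average over the [n] rotations, which the cycle lemma
    evaluates pair by pair. *)
Lemma sum_dominated (k n : nat) (la : seq nat) (Q : nat -> bool -> bool) :
  n * \sum_(b <- type_words (k * n).+1 la)
      \sum_(g <- bool_words n.+1 (sumn la).+1)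
        (dominated k n b g && Q (last 0 b) (last true g))
  = \sum_(b <- type_words (k * n).+1 la)
      \sum_(g <- bool_words n.+1 (sumn la).+1)
        Q (last 0 b) (last true g) * (~~ last true g + last 0 b).
Proof.
set Bs := type_words _ _; set Gs := bool_words _ _.
pose F b g : nat := dominated k n b g && Q (last 0 b) (last true g).
have rot_inv r : \sum_(b <- Bs) \sum_(g <- Gs) F b g =
    \sum_(b <- Bs) \sum_(g <- Gs)
      F (rot_prefix (k * n) (k * r) b) (rot_prefix n r g).
  have pB : perm_eq (map (rot_prefix (k * n) (k * r)) Bs) Bs.
    apply: perm_map_closed; [exact: type_words_uniq | exact: rot_prefix_inj |].
    by move=> b; rewrite (type_words_perm _ _ (perm_rot_prefix _ _ _)).
  have pG : perm_eq (map (rot_prefix n r) Gs) Gs.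
    apply: perm_map_closed; [exact: bool_words_uniq | exact: rot_prefix_inj |].
    move=> g; rewrite !mem_bool_words (perm_size (perm_rot_prefix _ _ _)).
    by rewrite (permP (perm_rot_prefix _ _ _)).
  rewrite -(perm_big _ pB) big_map; apply: eq_bigr => b _.
  by rewrite -(perm_big _ pG) big_map.
rewrite -{1}(card_ord n) -sum_nat_const (eq_bigr _ (fun r _ => rot_inv (val r))).
rewrite exchange_big; apply: eq_big_seq => b hb.
rewrite exchange_big; apply: eq_big_seq => g hg.
have sb : size b = (k * n).+1 by move: hb; rewrite mem_filter => /andP[/eqP].
have [sg cg] : size g = n.+1 /\ count id g = (sumn b).+1.
  by move: hg; rewrite mem_bool_words (sumn_type_words hb) => /andP[/eqP-> /eqP].
rewrite -(sum_dominated_rot sb sg cg) big_distrr; apply: eq_bigr => r _.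
by rewrite /F !last_rot_prefix ?sb ?sg // -mulnb mulnC.
Qed.

(* The entries of a random word are exchangeable, so the last one has mean
   [sumn la / m.+1]. *)
Lemma sum_last_type_words m la :
  m.+1 * \sum_(b <- type_words m.+1 la) last 0 b
    = size (type_words m.+1 la) * sumn la.
Proof.
set Bs := type_words _ _.
have sB b : b \in Bs -> size b = m.+1 by rewrite mem_filter => /andP[/eqP].
(* Rotation by [i] permutes the words and brings entry [i] to the front. *)
have nth_sum i : i < m.+1 -> \sum_(b <- Bs) nth 0 b i = \sum_(b <- Bs) head 0 b.
  move=> hi; have pB : perm_eq (map (rot i) Bs) Bs.
    apply: perm_map_closed; [exact: type_words_uniq | exact: rot_inj |].
    by move=> b hb; rewrite (type_words_perm _ _ (permEl (perm_rot i b))).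
  rewrite -[RHS](perm_big _ pB) big_map; apply: eq_big_seq => b /sB sb.
  by rewrite -nth0 /rot nth_cat size_drop sb subn_gt0 hi nth_drop addn0.
have -> : \sum_(b <- Bs) last 0 b = \sum_(b <- Bs) head 0 b.
  rewrite -(nth_sum m) //; apply: eq_big_seq => b /sB sb.
  by rewrite -nth_last sb.
rewrite -{1}(card_ord m.+1) -sum_nat_const.
rewrite (eq_bigr _ (fun i _ => esym (nth_sum _ (ltn_ord i)))) exchange_big.
rewrite (eq_big_seq (fun=> sumn la)) => [|b hb].
  by rewrite big_const_seq count_predT iter_addn_0 mulnC.
rewrite -(sumn_type_words hb) sumnE (big_nth 0) (sB _ hb) big_mkord.
by apply: eq_bigr.
Qed.

(** Deleting a final 0 is a bijection, since zeros do not affect the type. *)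
Lemma type_words_last0 m la : is_partition la ->
  \sum_(b <- type_words m.+1 la) (last 0 b == 0 : nat) = size (type_words m la).
Proof.
move=> hla; rewrite (sum_nat_pred (fun b => last 0 b == 0)) -size_filter.
have inj : injective (rcons^~ 0) by move=> s t /rcons_inj[].
rewrite -[RHS](size_map (rcons^~ 0)); apply: perm_size; apply: uniq_perm.
- by rewrite filter_uniq // type_words_uniq.
- by rewrite map_inj_uniq // type_words_uniq.
move=> b; rewrite mem_filter mem_type_words //; apply/idP/mapP => [|[c]].
  case/lastP: b => [|b x]; rewrite ?last_rcons //= => /andP[/eqP->].
  rewrite size_rcons eqSS filter_rcons => hb.
  by exists b; rewrite ?mem_type_words.
rewrite mem_type_words // => /andP[sc tc] ->.
by rewrite last_rcons size_rcons eqSS sc filter_rcons.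
Qed.

Lemma count_dominated (k n : nat) (la : seq nat) :
  n * \sum_(b <- type_words (k * n).+1 la)
      \sum_(g <- bool_words n.+1 (sumn la).+1) dominated k n b g
  = size (type_words (k * n).+1 la) * 'C(n, (sumn la).+1)
    + 'C(n.+1, (sumn la).+1) * \sum_(b <- type_words (k * n).+1 la) last 0 b.
Proof.
have := sum_dominated k n la (fun _ _ => true).
under eq_bigr do under eq_bigr do rewrite andbT.
move=> ->; under eq_bigr do under eq_bigr do rewrite mul1n.
under eq_bigr do rewrite big_split bool_words_last_false /=.
rewrite big_split /= big_const_seq count_predT iter_addn_0 mulnC; congr (_ + _).
rewrite big_distrr; apply: eq_bigr => b _ /=.
by rewrite -size_bool_words big_const_seq count_predT iter_addn_0 mulnC.
Qed.

(** Where the condition on the last entries holds, the weight [~~ last true g + last 0 b] is 1, so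
    the double sum factors. *)
Lemma count_dominated_last0 (k n : nat) (la : seq nat) : is_partition la ->
  n * \sum_(b <- type_words (k * n).+1 la)
      \sum_(g <- bool_words n.+1 (sumn la).+1)
        (dominated k n b g && ((last 0 b == 0) && ~~ last true g))
  = size (type_words (k * n) la) * 'C(n, (sumn la).+1).
Proof.
move=> hla; rewrite (sum_dominated k n la (fun t e => (t == 0) && ~~ e)).
rewrite -(type_words_last0 _ hla) big_distrl; apply: eq_bigr => b _ /=.
rewrite -(bool_words_last_false n) big_distrr; apply: eq_bigr => g _ /=.
by case: eqP => [->|] //; case: (last true g).
Qed.

(** * Paths as east blocks interleaved with rising steps *)

(** The conditions of [is_fuss_schroder] other than the endpoint, for a path started at [(x, y)];
    this form allows induction along the path. *)
Fixpoint run_ok (k x y : nat) (p : seq step) : bool :=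
  (k * x <= y) &&
  if p is s :: q then
    ((s == Diag) ==> diag_start k y) &&
    run_ok k (x + (s != North)) (y + (s != East)) q
  else true.

Lemma all_iotaS (P : pred nat) m :
  all P (iota 0 m.+1) = P 0 && all (fun i => P i.+1) (iota 0 m).
Proof. by rewrite /= -[1]/(1 + 0) iotaDl all_map. Qed.

Lemma run_okE k x y p :
  run_ok k x y p =
    all (fun i => k * (x + xend (take i p)) <= y + yend (take i p))
      (iota 0 (size p).+1) &&
    all (fun i => (nth East p i == Diag) ==> diag_start k (y + yend (take i p)))
      (iota 0 (size p)).
Proof.
elim: p x y => [|s p IHp] x y; first by rewrite /= !addn0 !andbT.
rewrite [X in _ = X && _]all_iotaS [X in _ = _ && X]all_iotaS [LHS]/= IHp take0 !addn0.
rewrite andbACA -andbA; congr (andb _ (andb _ (andb _ _))).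
- by apply: eq_all => i /=; rewrite /xend /yend; case: s => /=; rewrite ?addn0; lia.
- apply: eq_all => i /=; congr (_ ==> diag_start k _).
  by rewrite /yend; case: s => /=; lia.
Qed.

Lemma run_ok_le k x y p : run_ok k x y p -> k * x <= y.
Proof. by case: p => [|s p] /= /andP[]. Qed.

(** Along an east run the constraint is tightest at its end. *)
Lemma run_ok_nseq_East k x y r p :
  run_ok k x y (nseq r East ++ p) = run_ok k (x + r) y p.
Proof.
elim: r x => [|r IHr] x /=; first by rewrite addn0.
rewrite addn0 addn1 IHr addSnnS; case ok: (run_ok _ _ _ _); rewrite ?andbF //.
have := run_ok_le ok; rewrite andbT => le; apply: leq_trans le.
by rewrite leq_mul2l leq_addr orbT.
Qed.

(* Inverse of splitting a path into its east blocks and its remaining steps;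
   meaningful when [size b = (size us).+1] and [us] has no east step. *)
Fixpoint weave (b : seq nat) (us : seq step) : seq step :=
  match b, us with
  | r :: b', u :: us' => nseq r East ++ u :: weave b' us'
  | r :: _, [::] => nseq r East
  | [::], _ => [::]
  end.

Lemma weaveK p : weave (east_blocks 0 p) [seq s <- p | s != East] = p.
Proof.
rewrite -[RHS]/(nseq 0 East ++ p); move: 0 => r.
elim: p r => [|[] p IHp] r /=; rewrite ?cats0 ?IHp //=.
by elim: r => //= r ->.
Qed.

Lemma size_east_blocks r p :
  size (east_blocks r p) = (count (fun s => s != East) p).+1.
Proof. by elim: p r => [|[] p IHp] r /=; rewrite ?IHp. Qed.

Section Weave.

Variables (b : seq nat) (us : seq step).
Hypotheses (sb : size b = (size us).+1) (us_up : East \notin us).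

Lemma east_blocks_weave : east_blocks 0 (weave b us) = b.
Proof.
have east_nseq r q p : east_blocks r (nseq q East ++ p) = east_blocks (r + q) p.
  by elim: q r => [|q IHq] r /=; rewrite ?addn0 // IHq addSnnS.
elim: us b sb us_up => [|u us' IH] [|r b'] //= [sb'].
  by case: b' sb' => // _ _; rewrite -[nseq _ _]cats0 east_nseq.
rewrite inE negb_or east_nseq => /andP[ne up].
by case: u ne => //= _; rewrite add0n IH.
Qed.

Lemma filter_weave : [seq s <- weave b us | s != East] = us.
Proof.
elim: us b sb us_up => [|u us' IH] [|r b'] //= [sb'].
  by rewrite filter_nseq.
rewrite inE negb_or filter_cat filter_nseq eq_sym /= => /andP[-> up].
by rewrite IH.
Qed.

Lemma xend_weave : xend (weave b us) = sumn b + count_mem Diag us.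
Proof.
rewrite /xend; elim: us b sb us_up => [|u us' IH] [|r b'] //= [sb'].
  by case: b' sb' => // _ _; rewrite !count_nseq /= mul1n mul0n !addn0.
rewrite inE negb_or !count_cat !count_nseq /= => /andP[ne up].
by have := IH _ sb' up; case: u ne => //= _; lia.
Qed.

Lemma yend_weave : yend (weave b us) = size us.
Proof.
rewrite /yend; elim: us b sb us_up => [|u us' IH] [|r b'] //= [sb'].
  by rewrite !count_nseq.
rewrite inE negb_or !count_cat !count_nseq /= => /andP[ne up].
by have := IH _ sb' up; case: u ne => //= _; lia.
Qed.

Lemma ends_diag_weave : ends_diag (weave b us) =
  (last 0 b == 0) && (last North us == Diag).
Proof.
have last_nseq x r : last x (nseq r East) = if r == 0 then x else East.
  by elim: r x => //= r IHr x; rewrite IHr; case: (r == 0).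
rewrite /ends_diag; elim: us North b sb => [|u us' IH] x [|r b'] //= [sb'].
  by case: b' sb' => //= _; rewrite last_nseq; case: (r == 0).
rewrite last_cat /= IH //.
by case: b' sb' => // r' b' _.
Qed.

(** Each step of [us] rises by 1, so step [i] starts at height [y + i], and only the rightmost
    vertex at each height has to be tested. *)
Lemma run_ok_weave k x y : run_ok k x y (weave b us) =
  all (fun i => k * (x + (sumn (take i.+1 b) + count_mem Diag (take i us))) <= y + i)
    (iota 0 (size us).+1) &&
  all (fun i => (nth East us i == Diag) ==> diag_start k (y + i)) (iota 0 (size us)).
Proof.
elim: us b sb us_up x y => [|u us' IH] [|r b'] // [sb'].
  case: b' sb' => //= _ _ x y.
  by rewrite -[nseq _ _]cats0 run_ok_nseq_East /= !addn0 !andbT.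
rewrite inE negb_or => /andP[ne up] x y.
rewrite [weave _ _]/= run_ok_nseq_East [run_ok _ _ _ _]/= IH //.
rewrite [X in _ = X && _]all_iotaS [X in _ = _ && X]all_iotaS take0 !addn0 andbACA -andbA.
congr (andb _ (andb _ (andb _ _))).
- by rewrite /= take0 /= addn0.
- by apply: eq_all => i /=; case: (u) ne => //= _; lia.
- by apply: eq_all => i /=; rewrite (eq_sym u) ne addn1 addSnnS.
Qed.

End Weave.

(** * Rising steps encoded by bits *)

(** The rising steps from height kj to kj + k: only the last of them starts on a line where a
    diagonal step is allowed, so one bit describes all of them. *)
Definition up_block (k : nat) (x : bool) : seq step :=
  rcons (nseq k.-1 North) (if x then North else Diag).

Definition up_steps (k : nat) (g : seq bool) : seq step :=
  flatten (map (up_block k) g).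

Lemma up_steps_cons k x g : up_steps k (x :: g) = up_block k x ++ up_steps k g.
Proof. by []. Qed.

Lemma size_up_block k x : 0 < k -> size (up_block k x) = k.
Proof. by move=> k0; rewrite size_rcons size_nseq prednK. Qed.

Lemma size_up_steps k g : 0 < k -> size (up_steps k g) = k * size g.
Proof.
by move=> k0; elim: g => [|x g IHg]; rewrite ?muln0 // up_steps_cons size_cat IHg size_up_block ?mulnS.
Qed.

Lemma East_up_steps k g : East \notin up_steps k g.
Proof.
elim: g => //= x g IHg; rewrite up_steps_cons mem_cat negb_or IHg andbT mem_rcons inE mem_nseq.
by rewrite andbF orbF; case: x.
Qed.

Lemma up_steps_inj k : 0 < k -> injective (up_steps k).
Proof.
move=> k0; elim=> [|x g IHg] [|y h] //=.
- by move/(congr1 size); rewrite up_steps_cons size_cat size_up_block //=; lia.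
- by move/(congr1 size); rewrite up_steps_cons size_cat size_up_block //=; lia.
move/eqP; rewrite !up_steps_cons eqseq_cat ?size_up_block // => /andP[/eqP /rcons_inj[xy]].
by move=> /eqP /IHg ->; case: x y xy => [] [].
Qed.

(** A diagonal step can only close a block, so the [r] steps of the incomplete block contribute
    none. *)
Lemma count_Diag_take_up_steps k g j r : r < k ->
  count_mem Diag (take (k * j + r) (up_steps k g)) = count negb (take j g).
Proof.
move=> rk; have k0 : 0 < k by lia.
elim: g j => [|x g IHg] [|j] //; rewrite up_steps_cons ?muln0 ?add0n ?take0 /=.
  rewrite takel_cat ?size_up_block ?(ltnW rk) // /up_block -cats1 takel_cat.
    by rewrite take_nseq ?count_nseq //; lia.
  by rewrite size_nseq; lia.
rewrite -IHg mulnS -addnA -{1}(size_up_block x k0) takeD take_size_cat //.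
rewrite drop_size_cat // count_cat /up_block -cats1 count_cat count_nseq /=.
by case: x.
Qed.

Lemma count_Diag_up_steps k g : 0 < k ->
  count_mem Diag (up_steps k g) = count negb g.
Proof.
move=> k0; have := count_Diag_take_up_steps g (size g) k0.
by rewrite addn0 take_size -(size_up_steps g k0) take_size.
Qed.

Lemma last_up_steps k g : g != [::] ->
  last North (up_steps k g) = if last true g then North else Diag.
Proof.
case/lastP: g => // g x _; rewrite /up_steps map_rcons last_rcons.
by rewrite -cats1 flatten_cat /= cats0 last_cat last_rcons.
Qed.

Lemma diag_startD k j i : diag_start k (k * j + i) = diag_start k i.
Proof. by rewrite /diag_start mulnC modnMDl. Qed.

Lemma diag_start_small k i : i < k -> diag_start k i = (i == k.-1).
Proof. by move=> ik; rewrite /diag_start !modn_small //; lia. Qed.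

(** The condition is periodic in the height with period [k], so [us] can be cut into blocks of
    length [k] and each one treated separately. *)
Lemma up_stepsP k n us : 0 < k -> size us = k * n -> East \notin us ->
  reflect (exists2 g, size g = n & us = up_steps k g)
    (all (fun i => (nth East us i == Diag) ==> diag_start k i)
       (iota 0 (size us))).
Proof.
move=> k0; elim: n us => [|n IHn] us su up.
  case: us su up => [|u us] su _; last by rewrite muln0 in su.
  by apply: ReflectT; exists [::].
have su1 : size (take k us) = k by rewrite size_takel // su mulnS leq_addr.
have su2 : size (drop k us) = k * n by rewrite size_drop su mulnS addKn.
have up12 : (East \notin take k us) && (East \notin drop k us).
  by rewrite -negb_or -mem_cat cat_take_drop.
have /andP[up1 up2] := up12.
have -> : all (fun i => (nth East us i == Diag) ==> diag_start k i)
       (iota 0 (size us)) =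
    all (fun i => (nth East (take k us) i == Diag) ==> diag_start k i) (iota 0 k) &&
    all (fun i => (nth East (drop k us) i == Diag) ==> diag_start k i)
       (iota 0 (size (drop k us))).
  rewrite su su2 mulnS iotaD all_cat add0n -[X in iota X (k * n)](addn0 k) iotaDl all_map.
    congr (_ && _); apply: eq_in_all => i; rewrite mem_iota => hi /=.
    by rewrite nth_take.
  by have := diag_startD k 1 i; rewrite muln1 nth_drop => ->.
have blockP : reflect (exists x, take k us = up_block k x)
    (all (fun i => (nth East (take k us) i == Diag) ==> diag_start k i) (iota 0 k)).
  have nE i : i < k -> nth East (take k us) i != East.
    by move=> ik; apply: contraNneq up1 => <-; rewrite mem_nth // su1.
  apply: (iffP allP) => [h | [x ->] i].
    (* The bit records the last step of the block; all earlier ones must be north. *)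
    exists (nth East (take k us) k.-1 == North).
    apply: (@eq_from_nth _ East) => [|i]; first by rewrite size_up_block.
    rewrite su1 => ik; have := h i; rewrite mem_iota => /(_ ik).
    rewrite diag_start_small // nth_rcons size_nseq nth_nseq.
    have := nE _ ik; case: (ltngtP i k.-1) => [ik1|?|->]; try lia.
      by case: (nth _ _ _).
    by case: (nth _ _ _).
  rewrite mem_iota => /andP[_ ik]; rewrite diag_start_small // nth_rcons size_nseq.
  by rewrite nth_nseq; case: ltngtP => //; lia.
apply: (iffP andP) => [[/blockP[x ex] /(IHn _ su2 up2)[g sg eg]] | [[|x g] // [sg] eg]].
  by exists (x :: g); rewrite /= ?sg // up_steps_cons -ex -eg cat_take_drop.
have /andP[/eqP e1 /eqP e2] : (take k us == up_block k x) && (drop k us == up_steps k g).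
  by rewrite -eqseq_cat ?su1 ?size_up_block // cat_take_drop eg -up_steps_cons.
by split; [apply/blockP; exists x | apply/(IHn _ su2 up2); exists g].
Qed.

(** * The bijection between paths and pairs of words *)

(** The first bit is the artificial g_0, which encodes no step and is dropped. *)
Definition decode (k : nat) (b : seq nat) (g : seq bool) : seq step :=
  weave b (up_steps k (behead g)).

(** Ending at abscissa [n] fixes the number of ones. Among the heights kj, ..., kj + k - 1 the bound
    on the abscissa is the same, at most j, so it only needs testing at the highest, where the
    abscissa is largest. *)
Lemma fuss_schroder_decode k n b g : 0 < k ->
  size b = (k * n).+1 -> size g = n ->
  is_fuss_schroder k n (decode k b (true :: g)) =
    (sumn b == count id g) && dominated k n b (true :: g).
Proof.
move=> k0 sb sg; rewrite /decode /=.
have sus : size (up_steps k g) = k * n by rewrite size_up_steps // sg.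
have up := East_up_steps k g.
have sbu : size b = (size (up_steps k g)).+1 by rewrite sus.
have cid m : count id (take m g) + count negb (take m g) = size (take m g).
  by rewrite -(count_predC id); congr (_ + _); apply: eq_count.
have cid_all := cid n; rewrite -sg take_size sg in cid_all.
have sumn_le i j : i <= j -> sumn (take i b) <= sumn (take j b).
  by move=> ij; rewrite -(subnKC ij) takeD sumn_cat leq_addr.
rewrite /is_fuss_schroder xend_weave // yend_weave // sus eqxx /=.
rewrite count_Diag_up_steps //.
have := run_okE k 0 0 (weave b (up_steps k g)).
under eq_all do rewrite !add0n.
under [in X in _ = _ && X -> _]eq_all do rewrite add0n.
move=> <-; rewrite run_ok_weave //.
under eq_all do rewrite !add0n.
under [in X in _ && (_ && X) = _]eq_all do rewrite add0n.
have -> : all (fun i => (nth East (up_steps k g) i == Diag) ==> diag_start k i)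
  (iota 0 (size (up_steps k g))) by apply/(up_stepsP k0 sus up); exists g.
rewrite andbT.
have -> : (sumn b + count negb g == n) = (sumn b == count id g).
  by apply/eqP/eqP; lia.
case: eqP => // sb_id; rewrite !andTb; apply/idP/idP => /allP dom; apply/allP.
  move=> [|j]; rewrite mem_iota // => hj.
  (* The inequality of index [j.+1] is the constraint at the top height of block [j]. *)
  have hin : k * j + k.-1 \in iota 0 (size (up_steps k g)).+1.
    by rewrite mem_iota sus; nia.
  have := dom _ hin; have -> : (k * j + k.-1).+1 = k * j.+1.
    by rewrite -addnS prednK // mulnSr.
  rewrite count_Diag_take_up_steps; last by lia.
  have := cid j; rewrite size_takel /=; last by lia.
  move: (sumn _) (count _ _) (count _ _) => S C C'; nia.
move=> i; rewrite mem_iota sus => /andP[_ hi].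
(* The final height is outside the range of [dominated]; there the endpoint lies on the boundary
   line. *)
have [ikn|ikn] := eqVneq i (k * n).
  rewrite ikn take_oversize ?sb // take_oversize ?sus // count_Diag_up_steps //.
  by rewrite leq_mul2l; lia.
have ilt : i < k * n by lia.
have jn : i %/ k < n by rewrite ltn_divLR // mulnC.
move: jn (ltn_pmod i k0); set j := i %/ k; set r := i %% k => jn hr.
have ei : i = k * j + r by rewrite mulnC -divn_eq.
have hin : j.+1 \in iota 1 n by rewrite mem_iota add1n !ltnS.
have /= := dom _ hin.
have le : sumn (take i.+1 b) <= sumn (take (k * j.+1) b).
  by apply: sumn_le; rewrite mulnS; lia.
have -> : count_mem Diag (take i (up_steps k g)) = count negb (take j g).
  by rewrite {1}ei count_Diag_take_up_steps.
have := cid j; rewrite size_takel; last by lia.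
move: le ei; move: (sumn _) (sumn _) (count _ _) (count _ _) => S S' C C'.
nia.
Qed.

(** The inequality for j = 1 is strict, which forces g_0 = 1. *)
Lemma head_dominated k n b g : 0 < n -> dominated k n b g -> head false g.
Proof.
case: n => // n _ /allP/(_ 1); rewrite mem_iota /= => /(_ isT).
by case: g => [|[] g] //=; rewrite take0 /= ltn0.
Qed.

(** An arbitrary [R] lets one bijection serve both counts. [decode] is injective because the east
    blocks and the rising steps can be read back from the path. *)
Lemma card_fuss_schroder k n la (R : pred (seq step)) :
  0 < k -> 0 < n -> is_partition la ->
  #|[set p : {bseq n + k * n of step} |
      [&& is_fuss_schroder k n p, path_type p == la & R p]]| =
  \sum_(b <- type_words (k * n).+1 la)
    \sum_(g <- bool_words n.+1 (sumn la).+1)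
      (dominated k n b g && R (decode k b g)).
Proof.
move=> k0 n0 hla; set A := [set p | _].
set Bs := type_words _ _; set Gs := bool_words _ _.
pose S := [seq (b, g) | b <- Bs, g <- Gs].
pose P x := dominated k n x.1 x.2 && R (decode k x.1 x.2).
pose f x := decode k x.1 x.2.
have uS : uniq S.
  apply: allpairs_uniq; [exact: type_words_uniq | exact: bool_words_uniq |].
  by move=> [b g] [c h] _ _ [-> ->].
have inS b g : ((b, g) \in S) = (b \in Bs) && (g \in Gs).
  by apply/allpairsP/andP => [[[c h] /= [? ? [-> ->]]]|[? ?]] //; exists (b, g).
have SP x : x \in S -> P x -> exists b g,
    [/\ x = (b, true :: g), size b = (k * n).+1, size g = n,
        sumn b = count id g
      & path_type (decode k b (true :: g)) = la].
  case: x => b g; rewrite inS => /andP[hb hg] /andP[/(head_dominated n0) /=].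
  case: g hg => [|[] g] //; rewrite mem_bool_words /= add1n !eqSS.
  move=> /andP[/eqP sg /eqP cg] _ _; exists b, g; split=> //.
  - by move: hb; rewrite mem_filter => /andP[/eqP].
  - by rewrite (sumn_type_words hb).
  - have sb : size b = (k * n).+1 by move: hb; rewrite mem_filter => /andP[/eqP].
    move: hb; rewrite mem_type_words // => /andP[_ /eqP].
    rewrite /path_type east_blocks_weave ?East_up_steps //.
    by rewrite sb size_up_steps // sg.
have -> : \sum_(b <- Bs) \sum_(g <- Gs) (dominated k n b g && R (decode k b g))
    = size [seq x <- S | P x].
  by rewrite size_filter -(sum_nat_pred P) big_allpairs.
rewrite -(size_map f) cardE -(size_map val); apply: perm_size; apply: uniq_perm.
- by rewrite map_inj_uniq ?enum_uniq //; apply: val_inj.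
- rewrite map_inj_in_uniq ?filter_uniq // => x y.
  rewrite !mem_filter => /andP[Px xS] /andP[Py yS].
  have [b [g [-> sb sg _ _]]] := SP x xS Px.
  have [c [h [-> sc sh _ _]]] := SP y yS Py.
  rewrite /f /decode /= => e.
  have sbu : size b = (size (up_steps k g)).+1 by rewrite size_up_steps // sg.
  have scu : size c = (size (up_steps k h)).+1 by rewrite size_up_steps // sh.
  have /up_steps_inj -> // : up_steps k g = up_steps k h.
    by rewrite -(filter_weave sbu) ?e ?filter_weave ?East_up_steps.
  by rewrite -(east_blocks_weave sbu) ?e ?east_blocks_weave ?East_up_steps.
move=> p; apply/mapP/mapP => [[q + ->]|[x]].
  (* A path [q] comes from its own east blocks and the bits of its rising steps. *)
  rewrite mem_enum inE => /and3P[fs /eqP tq Rq].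
  move: (fs) => /and4P[/eqP xq /eqP yq _ _].
  set b := east_blocks 0 q; set us := [seq s <- (q : seq step) | s != East].
  have sbu : size b = (size us).+1 by rewrite size_east_blocks size_filter.
  have up : East \notin us by rewrite mem_filter eqxx.
  have eq : weave b us = q := weaveK q.
  have sus : size us = k * n by rewrite -yq -(yend_weave sbu up) eq.
  have [g sg eus] : exists2 g, size g = n & us = up_steps k g.
    apply/(up_stepsP k0 sus up).
    have : run_ok k 0 0 q by rewrite run_okE; case/and4P: fs => _ _ h1 h2; apply/andP.
    by rewrite -eq run_ok_weave // => /andP[].
  have eq' : decode k b (true :: g) = q by rewrite /decode /= -eus.
  have sb : size b = (k * n).+1 by rewrite sbu sus.
  have := fs; rewrite -eq' fuss_schroder_decode // => /andP[/eqP sc dom].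
  have hb : b \in Bs by rewrite mem_type_words // sb eqxx; apply/eqP.
  exists (b, true :: g); last by rewrite /f eq'.
  rewrite mem_filter /P /= dom eq' Rq inS hb mem_bool_words /= sg eqxx.
  by rewrite add1n eqSS -sc (sumn_type_words hb) eqxx.
(* Conversely, a dominated pair decodes to a path, whose length bound makes it an element of the
   finite type. *)
rewrite mem_filter => /andP[Px xS] ->; move: (Px).
have [b [g [-> sb sg sbl tl]]] := SP x xS Px.
case/andP => dom Rx.
have fs : is_fuss_schroder k n (decode k b (true :: g)).
  by rewrite fuss_schroder_decode // sbl eqxx.
exists (Bseq (size_fuss_schroder fs)) => //.
by rewrite mem_enum inE /= fs tl eqxx.
Qed.

Lemma num_fuss_schroderE k n la : 0 < k -> 0 < n -> is_partition la ->
  num_fuss_schroder k n la =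
  \sum_(b <- type_words (k * n).+1 la)
    \sum_(g <- bool_words n.+1 (sumn la).+1) dominated k n b g.
Proof.
move=> k0 n0 hla; have := card_fuss_schroder predT k0 n0 hla.
under [RHS]eq_bigr do under eq_bigr do rewrite andbT.
by move=> <-; apply: eq_card => p; rewrite !inE andbT.
Qed.

Lemma num_fuss_schroder_diagE k n la : 0 < k -> 0 < n -> is_partition la ->
  num_fuss_schroder_diag k n la =
  \sum_(b <- type_words (k * n).+1 la)
    \sum_(g <- bool_words n.+1 (sumn la).+1)
      (dominated k n b g && ((last 0 b == 0) && ~~ last true g)).
Proof.
move=> k0 n0 hla.
rewrite /num_fuss_schroder_diag (card_fuss_schroder ends_diag k0 n0 hla).
apply: eq_big_seq => b hb; apply: eq_big_seq => g.
rewrite mem_bool_words => /andP[/eqP sg _].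
have sb : size b = (k * n).+1 by move: hb; rewrite mem_filter => /andP[/eqP].
case: (boolP (dominated k n b g)) => //= /(head_dominated n0).
case: g sg => [|[] g] //= [sg] _.
rewrite /decode ends_diag_weave ?East_up_steps ?size_up_steps ?sg //=.
(* As [n] is positive, a genuine last bit g_n exists and determines the last rising step. *)
rewrite last_up_steps; last by case: g sg n0 => //= <-.
by case: (last true g).
Qed.

(** * The closed formulas over the rationals *)

Local Open Scope ring_scope.

Theorem mainTheorem1 (k n : nat) (la : seq nat)
    (hk : (1 <= k)%N) (hn : (1 <= n)%N) (hla : is_partition la) :
  ((num_fuss_schroder k n la)%:R : rat) =
    1 / n%:R *
    ('C(n, (sumn la).+1)%:R
      + (sumn la)%:R / (k * n + 1)%:R * 'C(n.+1, (sumn la).+1)%:R) *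
    'C(k * n + 1, size la)%:R * ((size la)`!%:R / (mult_fact la)%:R)
  /\
  ((num_fuss_schroder_diag k n la)%:R : rat) =
    1 / n%:R * 'C(n, (sumn la).+1)%:R *
    'C(k * n, size la)%:R * ((size la)`!%:R / (mult_fact la)%:R).
Proof.
have n0 : (n%:R : rat) != 0 by rewrite pnatr_eq0; lia.
have kn0 : ((k * n + 1)%:R : rat) != 0 by rewrite pnatr_eq0; lia.
have m0 : ((mult_fact la)%:R : rat) != 0.
  by rewrite pnatr_eq0 -lt0n prodn_gt0 // => i; rewrite fact_gt0.
have natQ (x y : nat) : x = y -> x%:R = y%:R :> rat by move->.
have words m : (size (type_words m la))%:R =
    'C(m, size la)%:R * ((size la)`!%:R / (mult_fact la)%:R) :> rat.
  by rewrite mulrA -natrM -size_type_words // natrM mulfK.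
split; apply: (mulfI n0).
  rewrite num_fuss_schroderE // -natrM count_dominated -addn1 natrD !natrM.
  have := natQ _ _ (sum_last_type_words (k * n) la).
  rewrite -addn1 !natrM => hs.
  (* The exchangeability identity, divided by kn + 1, produces the coefficient |la| / (kn + 1). *)
  have -> : (\sum_(b <- type_words (k * n + 1) la) last 0%N b)%:R =
      (size (type_words (k * n + 1) la))%:R * (sumn la)%:R / (k * n + 1)%:R :> rat.
    by rewrite -hs [RHS]mulrC mulKf.
  rewrite words; move: (k * n + 1)%:R kn0 => c c0.
  by field; rewrite n0 c0 m0.
rewrite num_fuss_schroder_diagE // -natrM count_dominated_last0 // natrM words.
by field; rewrite n0 m0.
Qed.
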